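(* There is an absolute constant $C$ such that for every positive integer $n$ and every graph $G$ on $n$ vertices with maximum degree $2$, $\min\overline{R}(G)\leq Cn$.
   Context: An ordered graph is a pair $\mathcal{G}=(G,\prec)$ where $G$ is a (simple) graph and $\prec$ is a total ordering of its vertices; $\mathcal{G}$ is called an ordering of $G$. Two ordered graphs are isomorphic if there is a graph isomorphism between them preserving the vertex orderings. $\mathcal{K}_N$ denotes the (unique up to isomorphism) ordered complete graph on $N$ vertices. $\mathcal{G}=(G,\prec_1)$ is an ordered subgraph of $\mathcal{H}=(H,\prec_2)$ if $G$ is a subgraph of $H$ and $\prec_1$ is a suborder of $\prec_2$. The ordered Ramsey number $\overline{R}(\mathcal{G})$ is the minimum integer $N$ such that every $2$-coloring of the edges of $\mathcal{K}_N$ contains a monochromatic ordered subgraph isomorphic to $\mathcal{G}$. For a graph $G$, $\min\overline{R}(G):=\min\{\overline{R}(\mathcal{G}) : \mathcal{G}\text{ is an ordering of }G\}$. *)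

(* Defs.v *)
From HB Require Import structures.
From mathcomp Require Import all_boot.

Set Implicit Arguments.
Unset Strict Implicit.
Unset Printing Implicit Defensive.

Record sgraph := SGraph {
  vertex :> finType;
  adj : rel vertex;
  adj_sym : symmetric adj;
  adj_irrefl : irreflexive adj
}.

Definition edges (G : sgraph) : {set {set G}} :=
  [set e | [exists u, [exists v, adj u v && (e == [set u; v])]]].

Definition degree (G : sgraph) (v : G) : nat := #|[set w | adj v w]|.

Definition max_degree (G : sgraph) : nat := \max_(v : G) degree v.

(* A total ordering is its strict part, given as a set of pairs so that the
   orderings of a finite type form a finite type. *)
Definition strict_total (T : finType) (r : {set T * T}) : bool :=
  [&& [forall x, (x, x) \notin r],
      [forall x, forall y, forall z,
         ((x, y) \in r) ==> ((y, z) \in r) ==> ((x, z) \in r)] &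
      [forall x, forall y, [|| x == y, (x, y) \in r | (y, x) \in r]]].

Definition ordering (T : finType) : finType := {r : {set T * T} | strict_total r}.

Record ograph := OGraph {
  ograph_graph :> sgraph;
  ograph_ordering : ordering ograph_graph
}.

Definition olt (G : ograph) (u v : G) : bool := (u, v) \in val (ograph_ordering G).

Definition ordered_iso (G H : ograph) : bool :=
  [exists f : {ffun G -> H},
    [&& injectiveb f,
        [forall y, y \in codom f],
        [forall u, forall v, adj (f u) (f v) == adj u v] &
        [forall u, forall v, olt (f u) (f v) == olt u v]]].

Definition is_subgraph (H : sgraph) (W : {set H}) (F : {set {set H}}) : bool :=
  (F \subset edges H) && [forall e in F, e \subset W].

Section SubOrderedGraph.
Variables (H : ograph) (W : {set H}) (F : {set {set H}}).

Let V : finType := {x : H | x \in W}.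

(* [u != v] only serves to make this a simple graph for every [F]; it follows
   from the other conjunct when [is_subgraph W F]. *)
Definition sub_adj : rel V :=
  fun u v => (u != v) && ([set val u; val v] \in F).

Fact sub_adj_sym : symmetric sub_adj.
Proof. by move=> u v; rewrite /sub_adj eq_sym setUC. Qed.

Fact sub_adj_irrefl : irreflexive sub_adj.
Proof. by move=> u; rewrite /sub_adj eqxx. Qed.

Definition sub_order : {set V * V} := [set p : V * V | olt (val p.1) (val p.2)].

Fact sub_order_strict_total : strict_total sub_order.
Proof.
have /and3P[irr tr tot] := valP (ograph_ordering H).
apply/and3P; split.
- by apply/forallP=> x; rewrite inE; exact: (forallP irr).
- apply/forallP=> x; apply/forallP=> y; apply/forallP=> z; rewrite !inE.
  exact: (forallP (forallP (forallP tr _) _) _).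
- apply/forallP=> x; apply/forallP=> y; rewrite !inE -(inj_eq val_inj).
  exact: (forallP (forallP tot _) _).
Qed.

Definition sub_ograph : ograph :=
  @OGraph (SGraph sub_adj_sym sub_adj_irrefl)
          (exist _ sub_order sub_order_strict_total).

End SubOrderedGraph.

Section CompleteOrderedGraph.
Variable N : nat.

Definition complete_adj : rel 'I_N := fun i j => i != j.

Fact complete_adj_sym : symmetric complete_adj.
Proof. by move=> i j; rewrite /complete_adj eq_sym. Qed.

Fact complete_adj_irrefl : irreflexive complete_adj.
Proof. by move=> i; rewrite /complete_adj eqxx. Qed.

Definition complete_order : {set 'I_N * 'I_N} := [set p : 'I_N * 'I_N | p.1 < p.2].

Fact complete_order_strict_total : strict_total complete_order.
Proof.
apply/and3P; split.
- by apply/forallP=> x; rewrite inE ltnn.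
- apply/forallP=> x; apply/forallP=> y; apply/forallP=> z; rewrite !inE /=.
  by apply/implyP=> xy; apply/implyP; exact: ltn_trans.
- apply/forallP=> x; apply/forallP=> y; rewrite !inE /= -val_eqE /=.
  by case: ltngtP.
Qed.

Definition complete_ograph : ograph :=
  @OGraph (SGraph complete_adj_sym complete_adj_irrefl)
          (exist _ complete_order complete_order_strict_total).

End CompleteOrderedGraph.

Definition edge (G : sgraph) : finType := {e : {set G} | e \in edges G}.

Definition edge_colouring (G : sgraph) : finType := {ffun edge G -> bool}.

Definition monochromatic (H : sgraph) (c : edge_colouring H) (F : {set {set H}}) :
  bool := [exists b, forall e : edge H, (val e \in F) ==> (c e == b)].

Definition has_mono_copy (G H : ograph) (c : edge_colouring H) : bool :=
  [exists W : {set H}, exists F : {set {set H}},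
    [&& is_subgraph W F, monochromatic c F & ordered_iso G (sub_ograph W F)]].

Definition arrows (G : ograph) (N : nat) : bool :=
  [forall c : edge_colouring (complete_ograph N), has_mono_copy G c].

(* Ramsey's theorem for complete ordered graphs, needed for the ordered Ramsey
   number to be a minimum over a nonempty set. *)
Section Existence.

Lemma ramsey_pairwise a b : exists N, forall (T : eqType) (c : rel T) (s : seq T),
  N <= size s ->
  (exists t, [/\ subseq t s, size t = a & pairwise c t]) \/
  (exists t, [/\ subseq t s, size t = b & pairwise (fun x y => ~~ c x y) t]).
Proof.
have [k] := ubnP (a + b); elim: k a b => // k IH [|a] [|b] ltk.
- by exists 0 => T c s _; left; exists [::]; rewrite sub0seq.
- by exists 0 => T c s _; left; exists [::]; rewrite sub0seq.
- by exists 0 => T c s _; right; exists [::]; rewrite sub0seq.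
have [|N1 P1] := IH a b.+1; first by rewrite addSn in ltk.
have [|N2 P2] := IH a.+1 b; first by rewrite addnS in ltk.
exists (N1 + N2).+1 => T c [//|x s]; rewrite /= ltnS => les.
have: N1 <= size (filter (c x) s) \/ N2 <= size (filter (predC (c x)) s).
  rewrite !size_filter; have := les; rewrite -(count_predC (c x) s).
  have [|lt1] := leqP N1 (count (c x) s); first by left.
  have [|lt2] := leqP N2 (count (predC (c x)) s); first by right.
  by rewrite leqNgt (leq_trans _ (leq_add lt1 (ltnW lt2))).
case=> [/P1|/P2] => /(_ c)[] [t [st szt pt]].
- left; exists (x :: t); split; rewrite /= ?eqxx ?szt //.
    exact: subseq_trans st (filter_subseq _ _).
  rewrite pt andbT; apply/allP=> y /(mem_subseq st).
  by rewrite mem_filter => /andP[].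
- right; exists t; split=> //.
  exact: subseq_trans st (subseq_trans (filter_subseq _ _) (subseq_cons _ _)).
- left; exists t; split=> //.
  exact: subseq_trans st (subseq_trans (filter_subseq _ _) (subseq_cons _ _)).
- right; exists (x :: t); split; rewrite /= ?eqxx ?szt //.
    exact: subseq_trans st (filter_subseq _ _).
  rewrite pt andbT; apply/allP=> y /(mem_subseq st).
  by rewrite mem_filter => /andP[].
Qed.

Section OrderFacts.
Variable G : ograph.
Implicit Types u v w : G.

Lemma olt_irr u : olt u u = false.
Proof.
by have /and3P[/forallP/(_ u)/negbTE] := valP (ograph_ordering G).
Qed.

Lemma olt_trans : transitive (@olt G).
Proof.
have /and3P[_ tr _] := valP (ograph_ordering G).
move=> v u w uv vw.
have /forallP/(_ v)/forallP/(_ w) := forallP tr u.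
by move=> /implyP/(_ uv)/implyP/(_ vw).
Qed.

Lemma olt_total u v : [|| u == v, olt u v | olt v u].
Proof.
have /and3P[_ _ tot] := valP (ograph_ordering G).
exact: (forallP (forallP tot u) v).
Qed.

Lemma olt_asym u v : olt u v -> olt v u = false.
Proof.
by move=> uv; apply/negP=> vu; have := olt_trans uv vu; rewrite olt_irr.
Qed.

Definition orank v : nat := #|[set u | olt u v]|.

Lemma orank_lt v : orank v < #|G|.
Proof.
rewrite -cardsT; apply: proper_card; apply/properP; split=> //.
by exists v; rewrite ?inE // olt_irr.
Qed.

Lemma orank_mono u v : olt u v -> orank u < orank v.
Proof.
move=> uv; apply: proper_card; apply/properP; split.
  by apply/subsetP=> w; rewrite !inE => /olt_trans; apply.
by exists u; rewrite !inE ?olt_irr.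
Qed.

End OrderFacts.

Lemma has_mono_copy_embedding (G H : ograph) (c : edge_colouring H) (b : bool)
    (f : G -> H) :
  {homo f : u v / olt u v} ->
  {homo f : u v / adj u v} ->
  (forall (e : edge H) u v, adj u v -> val e = [set f u; f v] -> c e = b) ->
  has_mono_copy G c.
Proof.
move=> fo fa fc.
have fI : injective f.
  move=> u v fuv; have /or3P[/eqP //|/fo|/fo] := olt_total u v;
  by rewrite fuv olt_irr.
pose W := [set f x | x in G].
pose F := [set e | [exists u, exists v, adj u v && (e == [set f u; f v])]].
have fW x : f x \in W by apply: imset_f.
apply/existsP; exists W; apply/existsP; exists F; apply/and3P; split.
- apply/andP; split.
    apply/subsetP=> e; rewrite !inE => /existsP[u /existsP[v /andP[uv /eqP->]]].
    by apply/existsP; exists (f u); apply/existsP; exists (f v); rewrite fa /=.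
  apply/forallP=> e; apply/implyP; rewrite inE.
  move=> /existsP[u /existsP[v /andP[uv /eqP->]]].
  by apply/subsetP=> x; rewrite !inE => /orP[]/eqP->.
- apply/existsP; exists b; apply/forallP=> e; apply/implyP; rewrite inE.
  by move=> /existsP[u /existsP[v /andP[uv /eqP euv]]]; rewrite (fc e u v).
pose g : {ffun G -> sub_ograph W F} := [ffun x => exist _ (f x) (fW x)].
apply/existsP; exists g; apply/and4P; split.
- by apply/injectiveP=> u v; rewrite !ffunE => -[/fI].
- apply/forallP=> -[y yW]; have /imsetP[x _ yx] := yW.
  by apply/codomP; exists x; rewrite ffunE; apply: val_inj.
- apply/forallP=> u; apply/forallP=> v; rewrite !ffunE /= /sub_adj /=.
  rewrite -(inj_eq val_inj) /= (inj_eq fI) inE; apply/eqP.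
  apply/andP/idP => [[nuv /existsP[u' /existsP[v' /andP[uv' /eqP/setP E]]]]|uv].
    have := E (f u); have := E (f v).
    rewrite !inE !(inj_eq fI) !eqxx orbT /=.
    move=> /esym/orP[]/eqP vE /esym/orP[]/eqP uE; subst => //.
    + by rewrite eqxx in nuv.
    + by rewrite adj_sym.
    + by rewrite eqxx in nuv.
  split; first by apply: contraTneq uv => ->; rewrite adj_irrefl.
  by apply/existsP; exists u; apply/existsP; exists v; rewrite uv /=.
- apply/forallP=> u; apply/forallP=> v; rewrite !ffunE {1}/olt /= inE /=.
  apply/eqP; apply/idP/idP=> [fuv|/fo //].
  have /or3P[/eqP uv|//|/fo fvu] := olt_total u v.
    by rewrite uv olt_irr in fuv.
  by rewrite (olt_asym fuv) in fvu.
Qed.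

Lemma arrows_exists (G : ograph) : exists N, arrows G N.
Proof.
have [N PN] := ramsey_pairwise #|G| #|G|; exists N; apply/forallP=> c.
pose r (i j : 'I_N) := if insub [set i; j] is Some e then c e else false.
have ltP : pairwise (fun i j : 'I_N => i < j) (enum 'I_N).
  rewrite -(pairwise_map val ltn) val_enum_ord -sorted_pairwise.
    exact: iota_ltn_sorted.
  exact: ltn_trans.
have key t b : subseq t (enum 'I_N) -> size t = #|G| ->
    pairwise (fun i j => r i j == b) t -> has_mono_copy G c.
  move=> st szt pt.
  have tlt := subseq_pairwise st ltP.
  have szi (v : G) : orank v < size t by rewrite szt; exact: orank_lt.
  have [v0 _|G0] := pickP (@predT G); last first.
    have f (v : G) : complete_ograph N by have := G0 v.
    apply: (@has_mono_copy_embedding G _ c b f) => [u|u|e u];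
    by have := G0 u.
  have x0 : 'I_N by case: t szi {st szt pt tlt} => [/(_ v0)|x].
  pose f (v : G) : complete_ograph N := nth x0 t (orank v).
  have fr u v : olt u v -> ((f u : 'I_N) < (f v : 'I_N)) && (r (f u) (f v) == b).
    move=> /orank_mono uv; apply/andP; split.
      exact: (pairwiseP x0 tlt) (szi u) (szi v) uv.
    exact: (pairwiseP x0 pt) (szi u) (szi v) uv.
  have fc (e : edge (complete_ograph N)) u v :
      olt u v -> val e = [set f u; f v] -> c e = b.
    move=> /fr/andP[_ /eqP <-] E; rewrite /r.
    by rewrite -E valK.
  apply: (@has_mono_copy_embedding G _ c b f).
  - by move=> u v /fr/andP[fuv _]; rewrite /olt inE.
  - move=> u v uv; rewrite /= /complete_adj -val_eqE /= neq_ltn.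
    have /or3P[/eqP E|/fr/andP[-> _]//|/fr/andP[-> _]] := olt_total u v.
      by rewrite E adj_irrefl in uv.
    by rewrite orbT.
  - move=> e u v uv E; have /or3P[/eqP E'|uv'|vu'] := olt_total u v.
    + by rewrite E' adj_irrefl in uv.
    + exact: fc uv' E.
    + by apply: fc vu' _; rewrite setUC.
have [|[t [st szt pt]]|[t [st szt pt]]] := PN _ r (enum 'I_N).
- by rewrite size_enum_ord.
- by apply: (key t true) => //; apply: sub_pairwise pt => i j ->.
- by apply: (key t false) => //; apply: sub_pairwise pt => i j /negbTE->.
Qed.

End Existence.

Definition ordered_ramsey (G : ograph) : nat := ex_minn (arrows_exists G).

Definition ordered_ramsey_value (G : sgraph) (m : nat) : bool :=
  [exists r : ordering G, ordered_ramsey (OGraph r) == m].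

Fact ordered_ramsey_value_exists (G : sgraph) :
  exists m, ordered_ramsey_value G m.
Proof.
pose r : {set G * G} := [set p : G * G | enum_rank p.1 < enum_rank p.2].
have rP : strict_total r.
  apply/and3P; split.
  - by apply/forallP=> x; rewrite inE ltnn.
  - apply/forallP=> x; apply/forallP=> y; apply/forallP=> z; rewrite !inE /=.
    by apply/implyP=> xy; apply/implyP; exact: ltn_trans.
  - apply/forallP=> x; apply/forallP=> y; rewrite !inE /=.
    by rewrite -(inj_eq enum_rank_inj) -val_eqE /=; case: ltngtP.
exists (ordered_ramsey (OGraph (exist _ r rP : ordering G))).
by apply/existsP; exists (exist _ r rP).
Qed.

Definition min_ordered_ramsey (G : sgraph) : nat :=
  ex_minn (ordered_ramsey_value_exists G).

(* Main.v *)
(* A graph of maximum degree 2 has bandwidth at most 2: place the vertices one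
   by one, always continuing along the oldest edge that has a placed and an
   unplaced end; at most two such edges exist at any time. Order the vertices by
   (p mod 3, p), where p is the position.

   Split [N] into q intervals of length M, with q the Ramsey number of K_3. Each
   choice of one vertex per interval contains a monochromatic triangle, so one
   triple of intervals and one colour serve a positive proportion of the M^q
   choices. If M is a large multiple of n, these choices contain a sequence of
   length n in which the vertices of the three intervals are moved to the right
   in turn, one at each step. The successive new vertices then span a
   monochromatic ordered copy of the square of a path, which contains the graph. *)

Require Import Defs.
From mathcomp Require Import all_boot.
From mathcomp Require Import zify.

Set Implicit Arguments.
Unset Strict Implicit.
Unset Printing Implicit Defensive.

(** * Counting, and chains of choices of one point per interval *)

Lemma pigeonhole_rel (T L : finType) (P : T -> L -> bool) k :
  (forall x, exists l, P x l) -> k * #|L| < #|T| ->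
  exists l, k < #|[set x | P x l]|.
Proof.
move=> PT lt; apply/existsP; apply: contraLR lt => /existsPn H.
rewrite -leqNgt mulnC.
have -> : #|T| = \sum_(x : T) 1 by rewrite sum1_card.
have le1 : \sum_(x : T) 1 <= \sum_(x : T) \sum_(l : L) P x l.
  apply: leq_sum => x _; have [l Pl] := PT x.
  by rewrite (bigD1 l) //= Pl.
apply: leq_trans le1 _; rewrite exchange_big /= -sum_nat_const.
apply: leq_sum => l _; have := H l; rewrite -leqNgt.
by rewrite cardsE -sum1_card big_mkcond.
Qed.

Definition raises (q M : nat) (i : 'I_q) (g h : {ffun 'I_q -> 'I_M}) : bool :=
  (g i < h i) && [forall j, (j != i) ==> (h j == g j)].

Lemma raises_neq (q M : nat) (i j : 'I_q) (g h : {ffun 'I_q -> 'I_M}) :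
  raises i g h -> j != i -> h j = g j.
Proof. by case/andP=> _ /forallP/(_ j)/implyP H /H /eqP. Qed.

Lemma raises_leq (q M : nat) (i j : 'I_q) (g h : {ffun 'I_q -> 'I_M}) :
  raises i g h -> g j <= h j.
Proof.
move=> gh; have [->|ne] := eqVneq j i; first by case/andP: gh => /ltnW.
by rewrite (raises_neq gh ne).
Qed.

(* Discarding from [S] the elements that are lowest in direction [s 0] costs at
   most one element per line in that direction; the rest has a predecessor. *)
Lemma raising_chain (q M k : nat) (s : nat -> 'I_q.+1)
    (S : {set {ffun 'I_q.+1 -> 'I_M}}) :
  k * M ^ q < #|S| ->
  exists g : nat -> {ffun 'I_q.+1 -> 'I_M},
    (forall p, p <= k -> g p \in S) /\
    (forall p, p < k -> raises (s p) (g p) (g p.+1)).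
Proof.
elim: k s S => [|k IH] s S ltS.
  have /card_gt0P[g gS] : 0 < #|S| by lia.
  by exists (fun=> g).
pose S' := [set h in S | [exists g in S, raises (s 0) g h]].
have leD : #|S :\: S'| <= M ^ q.
  (* [rest g] determines the line through [g] in direction [s 0]; of two members of [S] on one line,
     the higher lies in [S']. *)
  pose rest (g : {ffun 'I_q.+1 -> 'I_M}) := [ffun j : 'I_q => g (lift (s 0) j)].
  have restI : {in S :\: S' &, injective rest}.
    move=> g h; rewrite !inE => /andP[gN gS] /andP[hN hS] /ffunP E.
    have {}E j : j != s 0 -> g j = h j.
      by rewrite eq_sym => /unlift_some[j' -> _]; have := E j'; rewrite !ffunE.
    have noR (g1 g2 : {ffun 'I_q.+1 -> 'I_M}) : g1 \in S -> g2 \in S ->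
        ~~ ((g2 \in S) && [exists g in S, raises (s 0) g g2]) ->
        (forall j, j != s 0 -> g1 j = g2 j) -> g2 (s 0) <= g1 (s 0).
      move=> S1 S2; rewrite S2 /= => /exists_inPn/(_ _ S1) nr E12.
      rewrite leqNgt; apply: contra nr => lt; rewrite /raises lt /=.
      by apply/forallP=> j; apply/implyP=> /E12 ->.
    apply/ffunP=> j; have [->|/E //] := eqVneq j (s 0).
    apply/val_inj/eqP; rewrite eqn_leq /=.
    by rewrite (noR h g) ?(noR g h) // => i /E.
  rewrite -(card_in_imset restI).
  by apply: leq_trans (max_card _) _; rewrite card_ffun !card_ord.
have ltS' : k * M ^ q < #|S'|.
  have /setIidPr SI : S' \subset S by apply/subsetP=> h; rewrite inE => /andP[].
  by have := cardsID S' S; rewrite SI; move: ltS; rewrite mulSn; lia.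
(* The chain inside [S'] follows the shifted directions, which leaves direction [s 0] for the step
   from a predecessor [g0] to its first element. *)
have [g [gS' gR]] := IH (fun p => s p.+1) S' ltS'.
have := gS' 0 isT; rewrite inE => /andP[_ /exists_inP[g0 g0S g0R]].
exists (fun p => if p is p'.+1 then g p' else g0); split=> [[|p]|[|p]] //.
- by rewrite ltnS => /gS'; rewrite inE => /andP[].
- exact: gR.
Qed.

Section Chain.
Variables (q M k : nat) (s : nat -> 'I_q) (g : nat -> {ffun 'I_q -> 'I_M}).
Hypothesis gR : forall p, p < k -> raises (s p) (g p) (g p.+1).

Lemma chain_leq p p' i : p <= p' <= k -> g p i <= g p' i.
Proof.
case/andP; elim: p' => [|p' IH]; first by rewrite leqn0 => /eqP->.
rewrite leq_eqVlt => /orP[/eqP-> //|lt ltk].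
exact: leq_trans (IH lt (ltnW ltk)) (raises_leq _ (gR ltk)).
Qed.

Lemma chain_lt p p' : p < p' <= k -> g p (s p) < g p' (s p).
Proof.
case/andP=> lt le; have /andP[H _] := gR (leq_trans lt le).
by apply: leq_trans H _; apply: chain_leq; rewrite lt.
Qed.

Lemma chain_const p p' i :
  p <= p' <= k -> (forall r, p <= r < p' -> i != s r) -> g p' i = g p i.
Proof.
case/andP; elim: p' => [|p' IH]; first by rewrite leqn0 => /eqP->.
rewrite leq_eqVlt => /orP[/eqP-> //|lt ltk ne].
rewrite (raises_neq (gR ltk)); last by apply: ne; rewrite -ltnS lt /=.
by apply: IH => // [|r /andP[r1 r2]]; [exact: ltnW | apply: ne; lia].
Qed.
End Chain.

(** * Linear ordered Ramsey numbers from bounded bandwidth *)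

Lemma min_ordered_ramsey_leq (G : sgraph) (r : ordering G) N :
  arrows (OGraph r) N -> min_ordered_ramsey G <= N.
Proof.
move=> aN; rewrite /min_ordered_ramsey; case: ex_minnP => m _ /(_ _) minm.
have le : ordered_ramsey (OGraph r) <= N.
  by rewrite /ordered_ramsey; case: ex_minnP => m' _; apply.
by apply: leq_trans le; apply: minm; apply/existsP; exists r.
Qed.

Section ResidueOrder.
Variables (T : finType) (f : T -> nat) (d : nat).

(** Each residue class becomes a block of consecutive vertices, to be embedded in a single
    interval. *)
Definition residue_lt (u v : T) : bool :=
  (f u %% d < f v %% d) || (f u %% d == f v %% d) && (f u < f v).

Definition residue_order : {set T * T} := [set p | residue_lt p.1 p.2].

Lemma residue_order_strict_total : injective f -> strict_total residue_order.
Proof.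
move=> fI; apply/and3P; split.
- by apply/forallP=> x; rewrite inE /residue_lt /= !ltnn andbF.
- do 3![apply/forallP=> ?]; apply/implyP; rewrite !inE /residue_lt /= => H.
  by apply/implyP; move: H; lia.
- do 2![apply/forallP=> ?]; rewrite !inE /residue_lt /= -(inj_eq fI); lia.
Qed.
End ResidueOrder.

(** For general [d] the triangle becomes a complete graph on [d.+1] vertices, so that any [d.+1]
    consecutive positions use distinct intervals. *)
Lemma min_ordered_ramsey_bandwidth (d : nat) :
  exists C : nat, forall (G : sgraph) (f : G -> nat),
    0 < #|G| -> injective f -> (forall v, f v < #|G|) ->
    (forall u v, adj u v -> f u <= f v + d) ->
    min_ordered_ramsey G <= C * #|G|.
Proof.
have [q0 Pq] := ramsey_pairwise d.+1 d.+1.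
pose q := q0.+1; pose L : finType := (d.+1.-tuple 'I_q * bool)%type.
(* A label in [L] records [d.+1] intervals and a colour. The host consists of [q] intervals of
   length [M], and the pigeonhole below needs [n * #|L| < M]. *)
exists (q * #|L|.+1) => G f G0 fI fG fd.
set n := #|G| in G0 fG *.
pose M := #|L|.+1 * n.
rewrite -mulnA -/M.
pose R : ordering G :=
  exist (@strict_total G) _ (residue_order_strict_total d.+1 fI).
apply: (@min_ordered_ramsey_leq G R (q * M)).
apply/forallP=> c.
have posP (i : 'I_q) (a : 'I_M) : i * M + a < q * M.
  by have := ltn_ord i; have := ltn_ord a; nia.
pose pos i a : 'I_(q * M) := Ordinal (posP i a).
(* The default [false] is taken exactly when [x = y]. *)
pose col x y := if insub [set x; y] is Some e then c e else false.
have colC x y : col x y = col y x by rewrite /col setUC.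
pose P (g : {ffun 'I_q -> 'I_M}) (l : L) :=
  pairwise (fun i j : 'I_q =>
    (i < j) && (col (pos i (g i)) (pos j (g j)) == l.2)) l.1.
have ltE : pairwise (fun i j : 'I_q => i < j) (enum 'I_q).
  rewrite -(pairwise_map val ltn) val_enum_ord -sorted_pairwise.
    exact: iota_ltn_sorted.
  exact: ltn_trans.
have PT g : exists l, P g l.
  have sz : q0 <= size (enum 'I_q) by rewrite size_enum_ord.
  have mk b t : subseq t (enum 'I_q) -> size t = d.+1 ->
      pairwise (fun i j => col (pos i (g i)) (pos j (g j)) == b) t ->
      exists l, P g l.
    move=> st /eqP szt pt; exists (Tuple szt, b); rewrite /P /=.
    rewrite -[pairwise _ _]/(pairwise [rel i j : 'I_q | (i < j) &&
      (col (pos i (g i)) (pos j (g j)) == b)] t).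
    by rewrite pairwise_relI (subseq_pairwise st ltE).
  have := Pq _ (fun i j => col (pos i (g i)) (pos j (g j))) _ sz.
  case=> -[t [st szt pt]]; [apply: (mk true t)|apply: (mk false t)] => //.
    by apply: sub_pairwise pt => i j ->.
  by apply: sub_pairwise pt => i j /negbTE->.
have [|[t b] ltS] := @pigeonhole_rel _ L P (n * M ^ q0) PT.
  rewrite card_ffun !card_ord expnS mulnAC ltn_pmul2r ?expn_gt0 /M; nia.
pose s p := nth ord0 t (p %% d.+1).
have [g [gS gR]] := raising_chain s ltS.
have szt p : p %% d.+1 < size t by rewrite size_tuple ltn_mod.
have sP p m m' : p <= n -> m %% d.+1 < m' %% d.+1 ->
    (s m < s m') && (col (pos (s m) (g p (s m))) (pos (s m') (g p (s m'))) == b).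
  move=> /gS; rewrite inE => /(pairwiseP ord0); apply; exact: szt.
have sI m m' : s m = s m' -> m %% d.+1 = m' %% d.+1.
  case: (ltngtP (m %% d.+1) (m' %% d.+1)) => // lt E.
    by have := sP 0 _ _ isT lt; rewrite E ltnn.
  by have := sP 0 _ _ isT lt; rewrite E ltnn.
(* Position [p] takes its point from [g p], just before the step to [g p.+1] raises it. *)
pose F (v : G) : complete_ograph (q * M) := pos (s (f v)) (g (f v) (s (f v))).
have edgeb u v : f u < f v -> adj u v -> col (F u) (F v) = b.
  move=> lt; rewrite adj_sym => /fd le.
  (* Interval [s (f v)] is not raised between [f u] and [f v], which differ by at most [d]; hence
     both points belong to the one choice [g (f u)]. *)
  have ne r : f u <= r < f v -> r %% d.+1 != f v %% d.+1.
    move=> /andP[r1 r2]; rewrite eq_sym eqn_mod_dvd 1?ltnW //.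
    by rewrite gtnNdvd ?subn_gt0 //; lia.
  have E : g (f v) (s (f v)) = g (f u) (s (f v)).
    apply: (chain_const gR); first by rewrite (ltnW lt) (ltnW (fG v)).
    by move=> r /ne; apply: contraNneq => /sI ->.
  rewrite /F E; have := ne (f u); rewrite leqnn lt neq_ltn => /(_ isT)/orP[] lt'.
    by have /andP[_ /eqP] := sP (f u) _ _ (ltnW (fG u)) lt'.
  rewrite colC.
  by have /andP[_ /eqP] := sP (f u) _ _ (ltnW (fG u)) lt'.
have colb u v : adj u v -> col (F u) (F v) = b.
  move=> uv; have [lt|lt|/fI E] := ltngtP (f u) (f v).
  - exact: edgeb.
  - by rewrite colC; apply: edgeb => //; rewrite adj_sym.
  - by rewrite E adj_irrefl in uv.
have Flt (u v : OGraph R) : olt u v -> (F u : 'I__) < (F v : 'I__).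
  (* A smaller residue means an earlier interval; with equal residues the point has been raised in
     the meantime. *)
  rewrite /olt /= inE /residue_lt /= => /orP[lt|/andP[/eqP E lt]].
    have /andP[lt' _] := sP 0 _ _ isT lt.
    apply: leq_trans (leq_addr _ _); apply: (@leq_trans ((s (f u)).+1 * M)).
      by rewrite mulSn addnC ltn_add2r.
    by rewrite leq_mul2r lt' orbT.
  have E' : s (f u) = s (f v) by rewrite /s E.
  by rewrite -E' ltn_add2l; apply: (chain_lt gR); rewrite lt ltnW.
apply: (@has_mono_copy_embedding (OGraph R) _ c b F).
- by move=> u v /Flt H; rewrite /olt inE.
- move=> u v uv; rewrite /= /complete_adj -val_eqE neq_ltn.
  have /or3P[/eqP E|/Flt->//|/Flt->] := @olt_total (OGraph R) u v.
    by rewrite E adj_irrefl in uv.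
  by rewrite orbT.
- by move=> e u v /colb <- E; rewrite /col -E valK.
Qed.

(** * Bandwidth of graphs of maximum degree at most 2 *)

Section Bandwidth.
Variable G : sgraph.
Hypothesis deg2 : forall v : G, degree v <= 2.
Implicit Types (s : seq G) (u v w : G).

Definition missing s v := #|[set w | adj v w & w \notin s]|.

Lemma missing_cons w s v : w \notin s -> missing s v = missing (w :: s) v + adj v w.
Proof.
move=> ws; rewrite /missing (cardsD1 w) inE ws andbT addnC; congr (_ + _).
apply: eq_card => x; rewrite !inE negb_or.
by case: (x == w) => //=; rewrite andbF.
Qed.

(** One of the at most two edges at [w] leads back to [u]. *)
Lemma missing_new w s u : u \in s -> adj u w -> missing (w :: s) w <= 1.
Proof.
move=> us uw; rewrite -ltnS; apply: leq_trans (deg2 w).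
apply: proper_card; apply/properP; split.
  by apply/subsetP=> x; rewrite !inE => /andP[].
by exists u; rewrite !inE adj_sym uw // us orbT.
Qed.

Lemma missing_gt0 s v : 0 < missing s v -> exists2 w, adj v w & w \notin s.
Proof. by move=> /card_gt0P[w]; rewrite inE => /andP[]; exists w. Qed.

(* The most recently placed vertex comes first in [s]. *)
Definition banded s :=
  [/\ uniq s,
      {in s &, forall u v, adj u v -> index u s <= index v s + 2},
      {in s, forall v, missing s v <= 2 - index v s} &
      {in s &, forall u v, index u s = 0 -> index v s = 1 ->
        missing s u + missing s v <= 2}].

(** The bounds in [banded] say that open edges, those to unplaced vertices, start at the two latest
    vertices and number at most two. Placing [w] shifts every index by one, so the vertex at index 1
    must have no open edge left. *)
Lemma banded_cons w s : banded s -> w \notin s ->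
  {in s, forall v, index v s = 1 -> missing (w :: s) v = 0} ->
  {in s, forall u, index u s = 0 ->
     missing (w :: s) u <= 1 /\ missing (w :: s) w + missing (w :: s) u <= 2} ->
  banded (w :: s).
Proof.
move=> [us band miss _] ws m1 m0.
have new u : u \in s -> adj u w -> index u s <= 1.
  by move=> uS uw; have := miss u uS; rewrite (missing_cons _ ws) uw; lia.
have neq u : u \in s -> (w == u) = false.
  by move=> uS; apply: contraNF ws => /eqP->.
split.
- by rewrite /= ws.
- move=> u v; rewrite !inE /= ![w == _]eq_sym.
  case: eqP => [->|_] //= uS; case: eqP => [->|_] //= vS uv.
    by have := new u uS uv; lia.
  by have := band u v uS vS uv; lia.
- move=> v; rewrite inE /= [w == v]eq_sym; case: eqP => [-> _|_ /= vS].
    by apply: leq_trans (deg2 w); apply/subset_leq_card/subsetP=> x; rewrite !inE => /andP[].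
  case E: (index v s) => [|[|i]]; [by have [] := m0 v vS E | by rewrite m1 | ].
  by have := miss v vS; rewrite (missing_cons _ ws) E; lia.
- move=> u v; rewrite !inE /= ![w == _]eq_sym.
  case: eqP => [-> _|_ //]; case: eqP => [//|_] /= vS _ [] E.
  by have [] := m0 v vS E.
Qed.

(** The next vertex closes an open edge of the vertex at index 1 if there is one, else of the vertex
    at index 0. If no edge is open, [v] starts a new component. *)
Lemma banded_extend s v :
  banded s -> v \notin s -> exists2 w, w \notin s & banded (w :: s).
Proof.
move=> bs vs; have [us band miss sum] := bs.
have [/hasP[a aS /andP[/eqP a1 /missing_gt0[w aw ws]]]|/hasPn noA] :=
  boolP (has (fun a => (index a s == 1) && (0 < missing s a)) s).
  exists w => //; apply: banded_cons => // [x xS x1|x xS x0].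
    have -> : x = a by rewrite -(nth_index v xS) x1 -a1 nth_index.
    by have := miss a aS; rewrite (missing_cons _ ws) aw a1; lia.
  have := missing_new aS aw; have := sum x a xS aS x0 a1.
  by rewrite !(missing_cons _ ws) aw; lia.
have {}noA x : x \in s -> index x s = 1 -> missing s x = 0.
  by move=> /noA; case: eqP => //=; lia.
have [/hasP[a aS /andP[/eqP a0 /missing_gt0[w aw ws]]]|/hasPn noB] :=
  boolP (has (fun a => (index a s == 0) && (0 < missing s a)) s).
  exists w => //; apply: banded_cons => // [x xS x1|x xS x0].
    by have := noA x xS x1; rewrite (missing_cons _ ws); lia.
  have -> : x = a by rewrite -(nth_index v xS) x0 -a0 nth_index.
  have := missing_new aS aw; have := miss a aS.
  by rewrite !(missing_cons _ ws) aw a0; lia.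
exists v => //; apply: banded_cons => // [x xS x1|x xS x0].
  by have := noA x xS x1; rewrite (missing_cons _ vs); lia.
have x00 : missing (v :: s) x = 0.
  by have := noB x xS; rewrite x0 (missing_cons _ vs) /=; lia.
rewrite x00 addn0; split=> //; apply: leq_trans (deg2 v).
by apply/subset_leq_card/subsetP=> y; rewrite !inE => /andP[].
Qed.

Lemma max_degree2_bandwidth : exists f : G -> nat,
  [/\ injective f, forall v, f v < #|G| &
      forall u v, adj u v -> f u <= f v + 2].
Proof.
have [s [us band _ _] szs] : exists2 s, banded s & size s = #|G|.
  have: forall k, k <= #|G| -> exists2 s, banded s & size s = k.
    elim=> [_|k IH lt]; first by exists [::].
    have [s bs szs] := IH (ltnW lt).
    have [v vs] : exists v, v \notin s.
      apply/existsP; apply: contraLR lt => /existsPn H; rewrite -leqNgt -szs.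
      have [us _ _ _] := bs; rewrite -(card_uniqP us) subset_leq_card //.
      by apply/subsetP=> v _; have := H v; rewrite negbK.
    by have [w ws bws] := banded_extend bs vs; exists (w :: s) => //=; rewrite szs.
  exact.
have inS v : v \in s.
  have sub : {subset s <= enum G} by move=> x _; rewrite mem_enum.
  have le : size (enum G) <= size s by rewrite szs cardE.
  by have [_ ->] := uniq_min_size us sub le; rewrite mem_enum.
(* Positions count back from the last placed vertex; the bandwidth bound is symmetric under this
   reversal. *)
exists (fun v => index v s); split.
- by move=> u v E; rewrite -(nth_index u (inS u)) E nth_index.
- by move=> v; rewrite -szs index_mem.
- by move=> u v; apply: band.
Qed.
End Bandwidth.

Theorem theorem3p2 :
  exists C : nat, forall (n : nat) (G : sgraph),
    0 < n -> #|G| = n -> max_degree G = 2 -> min_ordered_ramsey G <= C * n.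
Proof.
have [C HC] := min_ordered_ramsey_bandwidth 2.
exists C => n G n0 cardG md; rewrite -cardG in n0 *.
have deg2 (v : G) : degree v <= 2 by rewrite -md; exact: leq_bigmax.
by have [f [fI fG fd]] := max_degree2_bandwidth deg2; exact: HC fI fG fd.
Qed.
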